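(* Suppose $S$ is a semigroup or monoid which has maximal global cogrowth with respect to some finite choice of generators, and let $K$ be any finite subset of $S^1$. Then the monoid $S^1$ has maximal global cogrowth with respect to some finite choice of generators containing a representative for every element of $K$ (that is, for every $k \in K$ there is a generator symbol in the choice of generators which maps to $k$).
   Context: $S^1$ denotes $S$ with an identity element adjoined if $S$ has no identity, and $S^1 = S$ if $S$ is already a monoid. $X^+$ (respectively $X^*$) denotes the free semigroup (free monoid) on a set $X$, and $|w|$ the length of a word $w$. A finite choice of generators for a semigroup (or monoid) $S$ is a finite set $X$ of symbols together with a surjective morphism from $X^+$ (or from $X^*$) onto $S$, $w \mapsto \overline{w}$ (several symbols may map to the same element). The global cogrowth function $\gamma^{S,X}(n)$ ($n\geq 1$) is the number of pairs $(u,v)$ of non-empty words over $X$ with $|u|+|v|=n$ and $\overline{u}=\overline{v}$ in $S$. The global cogrowth rate is $\gamma^{S,X}=\limsup_{n\to\infty}(\gamma^{S,X}(n))^{1/n}$; it always satisfies $\gamma^{S,X}\leq |X|$. $S$ has maximal global cogrowth with respect to $X$ if $\gamma^{S,X}=|X|$. *)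

(* Defs.v *)
From HB Require Import structures.
From mathcomp Require Import all_boot all_order all_algebra finmap.
From mathcomp Require Import all_classical all_reals all_analysis.

Set Implicit Arguments.
Unset Strict Implicit.
Unset Printing Implicit Defensive.

Import Order.TTheory GRing.Theory Num.Theory.
Local Open Scope classical_set_scope.
Local Open Scope ring_scope.

(* X^* and X^+, with concatenation as the product. *)

Definition free_monoid (X : choiceType) : Type := seq X.

HB.instance Definition _ (X : choiceType) := Choice.on (free_monoid X).
HB.instance Definition _ (X : choiceType) :=
  isMonoid.Build (free_monoid X) (@catA X) (@cat0s X) (@cats0 X).

Definition free_semigroup (X : choiceType) : Type :=
  {w : free_monoid X | w != [::]}.

HB.instance Definition _ (X : choiceType) := Choice.on (free_semigroup X).

Section FreeSemigroup.
Variable X : choiceType.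
Implicit Types u v w : free_semigroup X.

Fact fsg_mul_subproof u v : (val u * val v)%g != [::] :> free_monoid X.
Proof. by case: u v => [[|x u]] //= _ [v _]. Qed.

Definition fsg_mul u v : free_semigroup X :=
  Sub (val u * val v)%g (fsg_mul_subproof u v).

Fact fsg_mulA : associative fsg_mul.
Proof. by move=> u v w; apply: val_inj; rewrite /= mulgA. Qed.

HB.instance Definition _ := isSemigroup.Build (free_semigroup X) fsg_mulA.

End FreeSemigroup.

Section AdjoinOne.
Variable S : semigroupType.

Definition is_identity (e : S) : Prop :=
  forall x : S, (e * x)%g = x /\ (x * e)%g = x.

Definition has_identity : Prop := exists e : S, is_identity e.

(* S^1 is realised inside option S: the extra point None is kept exactly when
   S has no identity. *)
Definition adjoin1 : Type :=
  {x : option S | (x != None) || ~~ `[< has_identity >]}.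

HB.instance Definition _ := Choice.on adjoin1.

Definition to_adjoin1 (s : S) : adjoin1 :=
  @Sub _ _ adjoin1 (Some s) isT.

Definition omul (x y : option S) : option S :=
  match x, y with
  | None, _ => y
  | _, None => x
  | Some a, Some b => Some (a * b)%g
  end.

Fact adjoin1_mul_subproof (x y : adjoin1) :
  (omul (val x) (val y) != None) || ~~ `[< has_identity >].
Proof. by case: x y => [[a|] px] [[b|] py]. Qed.

Definition adjoin1_mul (x y : adjoin1) : adjoin1 :=
  Sub (omul (val x) (val y)) (adjoin1_mul_subproof x y).

Definition adjoin1_one : adjoin1 :=
  match pselect has_identity with
  | left h => to_adjoin1 (projT1 (cid h))
  | right h => @Sub _ _ adjoin1 None (introN (asboolP _) h)
  end.

Fact adjoin1_mulA : associative adjoin1_mul.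
Proof.
move=> [[a|] pa] [[b|] pb] [[c|] pc]; apply: val_inj => //=.
by rewrite mulgA.
Qed.

Fact adjoin1_mul1 : left_id adjoin1_one adjoin1_mul.
Proof.
rewrite /adjoin1_one => -[x px]; apply: val_inj; case: pselect => [h|h] //=.
case: x px => [a|] /= px; last by case/negP: px; apply/asboolP.
by case: (projT2 (cid h) a) => ->.
Qed.

Fact adjoin1_mulr1 : right_id adjoin1_one adjoin1_mul.
Proof.
rewrite /adjoin1_one => -[x px]; apply: val_inj; case: pselect => [h|h] /=.
  case: x px => [a|] /= px; last by case/negP: px; apply/asboolP.
  by case: (projT2 (cid h) a) => _ ->.
by case: x px.
Qed.

HB.instance Definition _ :=
  isMonoid.Build adjoin1 adjoin1_mulA adjoin1_mul1 adjoin1_mulr1.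

Lemma to_adjoin1M (a b : S) :
  to_adjoin1 (a * b)%g = (to_adjoin1 a * to_adjoin1 b)%g.
Proof. exact: val_inj. Qed.

Lemma to_adjoin1_inj : injective to_adjoin1.
Proof. by move=> a b /(congr1 val) []. Qed.

Lemma to_adjoin1_surj : has_identity -> forall x, exists a, to_adjoin1 a = x.
Proof.
move=> h [[a|] px]; first by exists a; apply: val_inj.
by case/negP: (px); apply/asboolP.
Qed.

Lemma adjoin1_new : ~ has_identity ->
  forall x : adjoin1, x = 1%g <-> ~ exists a, to_adjoin1 a = x.
Proof.
move=> h; have E : val (1%g : adjoin1) = None.
  have -> : (1%g : adjoin1) = adjoin1_one by [].
  by rewrite /adjoin1_one; case: pselect.
move=> x; split=> [-> [a /(congr1 val)]|]; first by rewrite E.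
by case: x => [[a|] px] nx; [case: nx; exists a|]; apply: val_inj => //; rewrite E.
Qed.

End AdjoinOne.

(* Finite choices of generators; the alphabet may be empty. *)

Record semigroup_generators (S : semigroupType) := SemigroupGenerators {
  sg_alphabet : finType;
  sg_eval : {multiplicative free_semigroup sg_alphabet -> S};
  sg_surj : forall s : S, exists w, sg_eval w = s
}.

Record monoid_generators (M : monoidType) := MonoidGenerators {
  mg_alphabet : finType;
  mg_eval : UMagmaMorphism.type (free_monoid mg_alphabet) M;
  mg_surj : forall m : M, exists w, mg_eval w = m
}.

Section Cogrowth.
Variables (R : realType) (X : finType) (T : Type).
(* Only non-empty words are counted, also for monoid generators. *)
Variable ev : free_semigroup X -> T.

Definition cogrowth_pairs (n : nat) : set (free_semigroup X * free_semigroup X) :=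
  [set p | (size (val p.1) + size (val p.2) = n)%N /\ ev p.1 = ev p.2].

(* fset_set sends infinite sets to fset0, so the cardinal below relies on this. *)
Lemma finite_cogrowth_pairs n : finite_set (cogrowth_pairs n).
Proof.
pose f (p : free_semigroup X * free_semigroup X) : seq X * seq X :=
  (val p.1, val p.2).
pose g (w : {bseq n of X} * {bseq n of X}) : seq X * seq X :=
  (val w.1, val w.2).
have f_inj : injective f.
  by move=> [u v] [u' v'] [] /= /val_inj -> /val_inj ->.
apply: (@sub_finite_set _ _ (f @^-1` (g @` setT))); last first.
  apply: finite_preimage; first by move=> p q _ _ /f_inj.
  exact/finite_image/finite_finset.
move=> [u v] [/= szE _].
have szu : (size (val u) <= n)%N by rewrite -szE leq_addr.
have szv : (size (val v) <= n)%N by rewrite -szE leq_addl.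
by exists (Bseq szu, Bseq szv).
Qed.

Definition global_cogrowth (n : nat) : nat := #|` fset_set (cogrowth_pairs n)|.

(* The limsup is taken in \bar R, so that it always exists; the junk term n = 0
   does not affect it. *)
Definition global_cogrowth_rate : \bar R :=
  limn_esup (fun n : nat => ((global_cogrowth n)%:R `^ n%:R^-1 : R)%:E).

Definition maximal_global_cogrowth : Prop :=
  global_cogrowth_rate = (#|X|%:R : R)%:E.

End Cogrowth.

Definition sg_maximal_cogrowth (R : realType) (S : semigroupType)
    (G : semigroup_generators S) : Prop :=
  maximal_global_cogrowth R (sg_eval G).

Definition mg_maximal_cogrowth (R : realType) (M : monoidType)
    (G : monoid_generators M) : Prop :=
  maximal_global_cogrowth R
    (fun w : free_semigroup (mg_alphabet G) => mg_eval G (val w)).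

Definition mg_represents (M : monoidType) (G : monoid_generators M)
    (K : set M) : Prop :=
  forall k, K k -> exists x : mg_alphabet G, mg_eval G [:: x] = k.

(* Main.v *)
Require Import Defs.
From HB Require Import structures.
From mathcomp Require Import all_boot all_order all_algebra finmap.
From mathcomp Require Import all_classical all_reals all_analysis.
From mathcomp Require Import zify ring lra.

Set Implicit Arguments.
Unset Strict Implicit.
Unset Printing Implicit Defensive.

Import Order.TTheory GRing.Theory Num.Theory.
Local Open Scope classical_set_scope.
Local Open Scope ring_scope.

(** Write [x] for the size of an alphabet, and [coincidences f i j] for the
    number of pairs of words of lengths [i] and [j] with the same value.  A
    pair [(i, j)] of lengths contributes at most [x ^ (i + j)] pairs, and only
    [n - 1] pairs of positive lengths have sum [n].  Polynomial factors do not
    affect exponential growth, so maximal cogrowth means that for every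
    [r < 1] some arbitrarily long pair of lengths satisfies
    [coincidences f i j >= (r * x) ^ (i + j)] (predicate [abundant], lemma
    [maximal_cogrowthP]).  In probabilistic terms: the chance that two
    independent uniform words of well-chosen lengths agree does not decay
    exponentially.

    In this form one may change the alphabet as soon as every pair of lengths
    for the old alphabet is turned into a pair of lengths for the new one
    with a loss of agreement probability that is polynomial in the lengths
    ([abundant_transfer]).  Two such changes are enough.

    - Padding: add as many symbols for the identity as there are generators,
      that is, pass from [X] to [X * bool] where [(x, false)] is evaluated to 1
      ([abundant_pad]).  A random word of length [2 i] over this alphabet
      is a random word of length exactly [i] over [X], interspersed with
      identities, with probability ['C(2 i, i) / 4 ^ i >= 1 / (2 i + 1)].
      Working with as many identity symbols as generators makes this balanced
      length the central one.
    - Blocks: take all words of length [m] as new symbols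
      ([abundant_blocks]).  Every word can be prolonged to a length divisible
      by [m] with an identity symbol, without changing its value, so only a
      constant factor is lost.  Without the first change this would fail: when
      the lengths of equal words are congruent modulo some number, as in a
      finite cyclic group, there is no way to adjust lengths.

    If [m] exceeds the lengths of chosen words for the elements of [K], each
    of these words, padded, is one of the new symbols.  The construction takes
    place in [S^1], which inherits generators from [S]; the injection of [S]
    into [S^1] preserves coincidences.  When the alphabet is empty the
    monoid is trivial, and a one-letter alphabet replaces it. *)

(** * Growth estimates and limits superior *)

(** With [h = (1 - r) / 7] one has [(1 + h) ^ 3 * r <= 1], because
    [r * (2 - r) <= 1]; by Bernoulli's inequality [(1 + h) ^ (3 n)] is at least
    a multiple of [(n + 1) ^ 3], which beats the quadratic factor. *)
Lemma quadratic_geometric_le1 (R : realType) (C r : R) : 0 <= r < 1 ->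
  exists N, forall n, (N <= n)%N -> C * n.+1%:R ^+ 2 * r ^+ n <= 1.
Proof.
move=> /andP[r0 r1].
pose h := (1 - r) / 7.
have h0 : 0 < h by rewrite /h; lra.
have h1 : h <= 1 by rewrite /h; lra.
have rE : r = 1 - 7 * h by rewrite /h; field.
clearbody h.
have base : (1 + h) ^+ 3 * r <= 1.
  have : (1 + h) ^+ 3 <= 1 + 7 * h by nra.
  by move=> /(ler_wpM2r r0) /le_trans; apply; rewrite rE; nra.
have bern n : h * n.+1%:R <= (1 + h) ^+ n.
  elim: n => [|n IHn]; first by rewrite mulr1 expr0.
  have ge1 : 1 <= (1 + h) ^+ n by apply: exprn_ege1; lra.
  by rewrite -natr1 exprS; nra.
exists (Num.bound (`|C| / h ^+ 3)) => n Nn.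
have Cn : C <= h ^+ 3 * n.+1%:R.
  apply: (le_trans (ler_norm _)); rewrite -ler_pdivrMl ?exprn_gt0// mulrC.
  have := archi_boundP (divr_ge0 (normr_ge0 C) (ltW (exprn_gt0 3 h0))).
  move=> /ltW /le_trans; apply; rewrite ler_nat; exact: leqW.
apply: (@le_trans _ _ ((h * n.+1%:R) ^+ 3 * r ^+ n)).
  rewrite ler_wpM2r ?exprn_ge0//.
  apply: (le_trans (ler_wpM2r _ Cn)); first by rewrite exprn_ge0.
  by set m := _.+1%:R; have -> : h ^+ 3 * m * m ^+ 2 = (h * m) ^+ 3 by ring.
apply: (@le_trans _ _ (((1 + h) ^+ n) ^+ 3 * r ^+ n)).
  have hn : 0 <= h * n.+1%:R by rewrite mulr_ge0// ltW.
  rewrite ler_wpM2r ?exprn_ge0// lerXn2r// nnegrE.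
  exact: le_trans hn (bern n).
rewrite exprAC -exprMn exprn_ile1// mulr_ge0// exprn_ge0//; lra.
Qed.

(** The form in which polynomial factors are absorbed throughout. *)
Lemma quadratic_geometric_le (R : realType) (C a b : R) : 0 <= a < b ->
  exists N, forall n, (N <= n)%N -> C * n.+1%:R ^+ 2 * a ^+ n <= b ^+ n.
Proof.
move=> /andP[a0 ab]; have b0 : 0 < b := le_lt_trans a0 ab.
have q01 : 0 <= a / b < 1 by rewrite divr_ge0 ?(ltW b0)//= ltr_pdivrMr// mul1r.
have [N HN] := quadratic_geometric_le1 C q01.
exists N => n /HN; rewrite expr_div_n mulrA ler_pdivrMr ?mul1r//.
exact: exprn_gt0.
Qed.

Lemma limn_esup_le_fin (R : realType) (u : nat -> R) (l : R) :
  (forall e, 0 < e -> exists N, forall n, (N <= n)%N -> u n <= l + e) ->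
  (limn_esup (fun n => (u n)%:E) <= l%:E)%E.
Proof.
move=> ul; apply/lee_addgt0Pr => e e0; have [N HN] := ul e e0.
apply: (@le_trans _ _
  (ereal_sup [set (u n)%:E | n in [set n | (N <= n)%N]])).
  by apply: ereal_inf_lbound; exists [set n | (N <= n)%N] => //; exists N.
by apply: ge_ereal_sup => _ [n /= Nn <-]; rewrite -EFinD lee_fin HN.
Qed.

Lemma limn_esup_ge_fin (R : realType) (u : nat -> R) (l : R) :
  (forall N, exists2 n, (N <= n)%N & l <= u n) ->
  (l%:E <= limn_esup (fun n => (u n)%:E))%E.
Proof.
move=> lu; apply: le_ereal_inf_tmp => _ [V [N _ NV] <-].
have [n Nn ln] := lu N.
apply: (@le_trans _ _ (u n)%:E); first by rewrite lee_fin.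
by apply: ereal_sup_ubound; exists n => //; apply: NV.
Qed.

Lemma limn_esup_gt_fin (R : realType) (u : nat -> R) (l : R) :
  (l%:E < limn_esup (fun n => (u n)%:E))%E ->
  forall N, exists2 n, (N <= n)%N & l < u n.
Proof.
move=> lu N.
have : (l%:E < ereal_sup [set (u n)%:E | n in [set n | (N <= n)%N]])%E.
  apply: (lt_le_trans lu); apply: ereal_inf_lbound.
  by exists [set n | (N <= n)%N] => //; exists N.
by move=> /ereal_sup_gt[_ [n /= Nn <-]]; rewrite lte_fin; exists n.
Qed.

Lemma root_compare (R : realType) (a b : R) n : (0 < n)%N -> 0 <= a -> 0 <= b ->
  (a <= b `^ n%:R^-1) = (a ^+ n <= b) /\ (b `^ n%:R^-1 <= a) = (b <= a ^+ n).
Proof.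
move=> n0 a0 b0; have nz : (n%:R : R) != 0 by rewrite pnatr_eq0 -lt0n.
have c0 : 0 <= b `^ n%:R^-1 := powR_ge0 _ _.
have cE : (b `^ n%:R^-1) ^+ n = b.
  by rewrite -powR_mulrn// -powRrM mulVf// powRr1.
by rewrite -[in b <= _]cE -[in _ <= b]cE !ler_pXn2r.
Qed.

(** * Coincidences of words *)

Definition word_eval (M : monoidType) (X : Type) (f : X -> M) (w : seq X) : M :=
  \big[*%g/1%g]_(x <- w) f x.

Definition coincidences (M : monoidType) (X : finType) (f : X -> M) i j : nat :=
  #|[pred p : i.-tuple X * j.-tuple X |
     word_eval f p.1 == word_eval f p.2]|.

(** Maximal cogrowth with the two lengths kept apart, which makes it possible
    to treat the two words of a pair separately. *)
Definition abundant (R : realType) (M : monoidType) (X : finType) (f : X -> M) :=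
  forall r : R, 0 <= r < 1 -> forall N, exists i j,
    [/\ (0 < i)%N, (0 < j)%N, (N <= i + j)%N &
        (r * #|X|%:R) ^+ (i + j) <= (coincidences f i j)%:R].

Section CogrowthCoincidences.
Variables (M : monoidType) (X : finType) (f : X -> M) (T : Type).
Variable ev : free_semigroup X -> T.
Hypothesis evP : forall u v : free_semigroup X,
  ev u = ev v <-> word_eval f (val u) = word_eval f (val v).

(** Positivity of the lengths matters: the cogrowth function counts non-empty
    words only. *)
Lemma coincidences_le_cogrowth i j : (0 < i)%N -> (0 < j)%N ->
  (coincidences f i j <= global_cogrowth ev (i + j))%N.
Proof.
move=> i0 j0; rewrite /coincidences cardE /global_cogrowth cardfE.
have nz k (u : k.-tuple X) : (0 < k)%N -> (u : free_monoid X) != [::].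
  by rewrite -size_eq0 size_tuple lt0n.
pose pt (p : i.-tuple X * j.-tuple X) : free_semigroup X * free_semigroup X :=
  (Sub (tval p.1) (nz i p.1 i0), Sub (tval p.2) (nz j p.2 j0)).
have pt_inj : injective pt by move=> [u v] [u' v'] [] /val_inj -> /val_inj ->.
rewrite -(size_map pt) -cardfE; apply: uniq_leq_size.
  by rewrite map_inj_uniq// enum_uniq.
move=> _ /mapP[[u v] +] ->; rewrite mem_enum /= => /eqP uv.
rewrite in_fset_set; last exact: finite_cogrowth_pairs.
by rewrite inE; split; rewrite /= ?size_tuple// evP.
Qed.

Lemma cogrowth_le_coincidences n :
  (global_cogrowth ev n <= \sum_(1 <= i < n) coincidences f i (n - i))%N.
Proof.
rewrite /global_cogrowth; set s := enum_fset (fset_set (cogrowth_pairs ev n)).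
have sP p : p \in s -> cogrowth_pairs ev n p.
  by rewrite in_fset_set ?inE//; exact: finite_cogrowth_pairs.
have szP p : p \in s -> (1 <= size (val p.1) < n)%N.
  move=> /sP[<- _]; case: p => -[[|a u] // _] [[|b v] // _] /=.
  by rewrite addnS ltnS ltnS leq_addr.
apply: (@leq_trans (\sum_(1 <= i < n) count (fun p => size (val p.1) == i) s)).
  under eq_bigr do rewrite -sum1_count big_mkcond.
  rewrite exchange_big -sum1_size big_seq [leqRHS]big_seq leq_sum// => p ps.
  rewrite (bigD1_seq (size (val p.1))) ?iota_uniq ?mem_index_iota ?szP//=.
  by rewrite eqxx.
rewrite big_nat [leqRHS]big_nat leq_sum// => i /andP[i0 ni].
rewrite -size_filter; set si := [seq _ <- _ | _].
(* An element of [si] is needed as the default value of [insubd]. *)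
case siE : si => [//|p0 si']; rewrite -siE.
pose mk (w : seq X) : free_semigroup X := insubd p0.1 (w : free_monoid X).
pose pt (p : i.-tuple X * (n - i).-tuple X) := (mk p.1, mk p.2).
rewrite /coincidences cardE -(size_map pt); apply: uniq_leq_size.
  by rewrite filter_uniq// fset_uniq.
move=> p; rewrite mem_filter => /andP[/= /eqP szi] /sP[szn /evP pE].
have szj : size (val p.2) == (n - i)%N by rewrite -szn szi addKn.
apply/mapP; exists (Tuple (introT eqP szi), Tuple szj).
  by rewrite mem_enum inE /=; apply/eqP.
by rewrite /pt /mk /= !valKd; case: p {szi szn pE szj}.
Qed.

Lemma coincidences_le i j : (coincidences f i j <= #|X| ^ (i + j))%N.
Proof.
apply: leq_trans (max_card _) _.
by rewrite card_prod !card_tuple expnD.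
Qed.

Lemma cogrowth_le n : (global_cogrowth ev n <= n * #|X| ^ n)%N.
Proof.
apply: leq_trans (cogrowth_le_coincidences n) _.
apply: (@leq_trans (\sum_(1 <= i < n) #|X| ^ n)).
  rewrite big_nat [leqRHS]big_nat leq_sum// => i /andP[_ /ltnW ni].
  by rewrite -[in leqRHS](subnKC ni) coincidences_le.
by rewrite sum_nat_const_nat leq_mul2r leq_subr orbT.
Qed.

(** Since [n] pairs of lengths share at most [n * x ^ n] pairs of words, the rate
    never exceeds [x]; and if it equals [x], the best of these pairs of lengths
    carries a fraction at least [1 / n] of them. *)
Lemma maximal_cogrowthP (R : realType) : (0 < #|X|)%N ->
  maximal_global_cogrowth R ev <-> abundant R f.
Proof.
move=> X0; have [x xE] : {x : R | x = #|X|%:R} by exists #|X|%:R.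
have x0 : 0 < x by rewrite xE ltr0n.
rewrite /maximal_global_cogrowth /abundant -xE; split => [gE|ab].
  move=> r /andP[r0 r1] N.
  have [r' rr' r'1] : exists2 r', r < r' & r' < 1.
    by exists ((r + 1) / 2); rewrite midf_lt.
  have r'0 : 0 < r' by exact: le_lt_trans r0 _.
  (* The factor 2 turns the final comparison into a strict one. *)
  have [N1 HN1] := @quadratic_geometric_le R 2 r r' (introT andP (conj r0 rr')).
  have lim_gt : ((r' * x)%:E < global_cogrowth_rate R ev)%E.
    by rewrite gE lte_fin gtr_pMl.
  have [n] := limn_esup_gt_fin lim_gt (N + N1).+1.
  have r'x0 : 0 < r' * x by exact: mulr_gt0.
  move=> Nn; have n0 : (0 < n)%N by lia.
  move=> /ltW; rewrite (root_compare n0 (ltW r'x0) (ler0n _ _)).1 => gn.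
  case: (pselect (exists2 i, (1 <= i < n)%N &
      (r * x) ^+ n <= (coincidences f i (n - i))%:R)).
    move=> [i /andP[i0 ni] ci]; exists i, (n - i)%N.
    by rewrite (subnKC (ltnW ni)); split => //; lia.
  move=> /forall2NP nex; exfalso.
  have : ((global_cogrowth ev n)%:R : R) <= n%:R * (r * x) ^+ n.
    apply: (@le_trans _ _ (\sum_(1 <= i < n) (r * x) ^+ n)).
      apply: (@le_trans _ _ (\sum_(1 <= i < n) (coincidences f i (n - i))%:R)).
        by rewrite -natr_sum ler_nat cogrowth_le_coincidences.
      rewrite big_nat [leRHS]big_nat ler_sum// => i ni.
      by case: (nex i) => // /negP; rewrite -ltNge => /ltW.
    rewrite sumr_const_nat -[leLHS]mulr_natl ler_wpM2r ?ler_nat ?leq_subr//.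
    by rewrite exprn_ge0// mulr_ge0// ltW.
  have : 2 * n.+1%:R ^+ 2 * (r * x) ^+ n <= (r' * x) ^+ n.
    by rewrite !(exprMn n) mulrA ler_pM2r ?exprn_gt0// HN1//; lia.
  have nn : (n%:R : R) <= n.+1%:R ^+ 2.
    by rewrite -natrX ler_nat; nia.
  have := ler_wpM2r (exprn_ge0 n (mulr_ge0 r0 (ltW x0))) nn.
  have := exprn_gt0 n r'x0.
  move: gn; set a := (_%:R : R); set b := (_ * _) ^+ n.
  set c := (_ * _) ^+ n => ? ? ? ? ?; lra.
apply/eqP; rewrite eq_le; apply/andP; split.
  apply: limn_esup_le_fin => e e0.
  have [|N HN] := @quadratic_geometric_le R 1 x (x + e); first lra.
  exists N.+1 => n Nn; have n0 : (0 < n)%N by lia.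
  rewrite (root_compare n0 (ltW (addr_gt0 x0 e0)) (ler0n _ _)).2.
  have := HN n (ltnW Nn); rewrite mul1r; apply: le_trans.
  apply: (@le_trans _ _ (n%:R * x ^+ n)).
    by rewrite xE -natrX -natrM ler_nat cogrowth_le.
  rewrite ler_wpM2r ?exprn_ge0 ?(ltW x0)//.
  by rewrite -natrX ler_nat; nia.
apply/lee_mul01Pr => [|r /andP[r0 r1]]; first by rewrite lee_fin ltW.
apply: limn_esup_ge_fin => N.
have [|i [j [i0 j0 Nij cij]]] := ab r _ N; first by rewrite (ltW r0).
exists (i + j)%N => //.
have ij0 : (0 < i + j)%N by rewrite addn_gt0 i0.
rewrite (root_compare ij0 (ltW (mulr_gt0 r0 x0)) (ler0n _ _)).1.
by apply: (le_trans cij); rewrite ler_nat coincidences_le_cogrowth.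
Qed.

End CogrowthCoincidences.

(** * Changing the alphabet *)

(** The hypothesis bounds the agreement frequency at lengths [(i, j)] by that at
    [(i', j')], up to a quadratic factor; the new lengths may grow arbitrarily
    but must not be shorter than a fixed fraction [1 / D] of the old ones. *)
Lemma abundant_transfer (R : realType) (M N : monoidType) (X Y : finType)
    (f : X -> M) (g : Y -> N) (C D : nat) :
  (0 < #|X|)%N -> (0 < #|Y|)%N ->
  (forall i j, (0 < i)%N -> (0 < j)%N -> exists i' j',
    [/\ (0 < i')%N, (0 < j')%N, (i + j <= D * (i' + j'))%N &
        (coincidences f i j * #|Y| ^ (i' + j') <=
         C * (i + j).+1 ^ 2 * coincidences g i' j' * #|X| ^ (i + j))%N]) ->
  abundant R f -> abundant R g.
Proof.
move=> X0 Y0 fg abf s /andP[s0 s1] K.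
have D0 : (0 < D)%N.
  have [i' [j' [_ _]]] := fg 1%N 1%N isT isT.
  by case: (D) => // -[].
have D20 : (0 < 2 * D)%N by rewrite muln_gt0.
(* With [r ^ (2 D) = s], one factor [r ^ n] pays for the quadratic loss
   and the other comes from [f]. *)
have r0 : 0 <= s `^ (2 * D)%:R^-1 := powR_ge0 _ _.
have r1 : s `^ (2 * D)%:R^-1 < 1.
  by rewrite ltNge (root_compare D20 ler01 s0).1 expr1n -ltNge.
have rs : (s `^ (2 * D)%:R^-1) ^+ (2 * D) = s.
  by rewrite -powR_mulrn// -powRrM mulVf ?powRr1// pnatr_eq0 -lt0n.
move: (s `^ _) r0 r1 rs => r r0 r1 rs.
have r01 : 0 <= r < 1 by rewrite r0.
have [N1 HN1] := quadratic_geometric_le1 C%:R r01.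
have [i [j [i0 j0]]] := abf r r01 (D * K + N1)%N.
have [i' [j' [i'0 j'0]]] := fg i j i0 j0.
set n := (i + j)%N; set k := (i' + j')%N => nDk PQ nbig cij.
exists i', j'; split => //; first by rewrite -(leq_pmul2l D0); lia.
move: PQ cij; rewrite -/k -(ler_nat R) !natrM !natrX.
move: (_ i j)%:R (_ i' j')%:R (ler0n R (coincidences g i' j')) => p q q0.
have x0 : 0 < #|X|%:R ^+ n :> R by rewrite exprn_gt0// ltr0n.
have y0 : 0 <= #|Y|%:R ^+ k :> R by rewrite exprn_ge0.
rewrite !exprMn => PQ /(ler_wpM2r y0) /le_trans /(_ PQ).
rewrite mulrAC ler_pM2r// => {}PQ.
have rn0 : 0 <= r ^+ n by rewrite exprn_ge0.
have sr : s ^+ k <= r ^+ n * r ^+ n.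
  by rewrite -exprD -rs -exprM ler_wiXn2l ?(ltW r1)//; lia.
apply: (le_trans (ler_wpM2r y0 sr)).
rewrite -mulrA; apply: (le_trans (ler_wpM2l rn0 PQ)).
have N1n : (N1 <= n)%N by rewrite (leq_trans _ nbig)// leq_addl.
have := ler_wpM2r q0 (HN1 n N1n); rewrite mul1r; apply: le_trans.
by rewrite [leLHS]mulrC mulrAC.
Qed.

(** * Adding symbols for the identity *)

(** The central coefficient is the largest of the [2 i + 1] in its row; the
    induction uses the recurrence between consecutive central ones. *)
Lemma expn4_le_central_binomial i : (4 ^ i <= i.*2.+1 * 'C(i.*2, i))%N.
Proof.
elim: i => // i IHi.
have binD : (i.+1 * 'C(i.+1.*2, i.+1) = 2 * (i.*2.+1 * 'C(i.*2, i)))%N.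
  have sym : 'C(i.*2.+1, i) = 'C(i.*2.+1, i.+1).
    rewrite -[LHS]bin_sub; last lia.
    by congr 'C(_, _); lia.
  by rewrite doubleS binS sym addnn -mul2n mulnCA -mul_bin_diag.
rewrite -(leq_pmul2l (ltn0Sn i)) expnS mulnCA.
have -> : (i.+1 * (i.+1.*2.+1 * 'C(i.+1.*2, i.+1)) =
  i.+1.*2.+1 * (i.+1 * 'C(i.+1.*2, i.+1)))%N by rewrite mulnCA.
rewrite binD; nia.
Qed.

Lemma sum_tupleS (T : finType) n (F : n.+1.-tuple T -> nat) :
  (\sum_t F t = \sum_x \sum_(t : n.-tuple T) F [tuple of x :: t])%N.
Proof.
rewrite pair_bigA /=; apply: reindex => /=.
exists (fun t => (thead t, [tuple of behead t])) => [[x t]|t] _ /=.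
  by rewrite theadE; congr pair; apply: val_inj.
by rewrite -tuple_eta.
Qed.

(** Double counting of the incidences [F x u]: the fibres are disjoint. *)
Lemma leq_card_fibers (T U : finType) (A : pred T) (B : pred U)
    (F : T -> pred U) (k : nat) :
  {in A, forall x, k <= #|F x|}%N ->
  {in A, forall x, {subset F x <= B}} ->
  {in A &, forall x y u, F x u -> F y u -> x = y} ->
  (#|A| * k <= #|B|)%N.
Proof.
move=> kF FB F_inj; rewrite -sum_nat_const.
apply: (@leq_trans (\sum_(x in A) \sum_(u in B) F x u)).
  apply: leq_sum => x xA; apply: (leq_trans (kF x xA)).
  rewrite -sum1_card [leqLHS]big_mkcond [leqRHS]big_mkcond leq_sum// => u _.
  by case: ifPn => // uF; rewrite (FB x xA u uF); move: uF; rewrite unfold_in => ->.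
rewrite exchange_big /= -sum1_card leq_sum// => u uB.
case: (pickP [pred x in A | F x u]) => [x /andP[xA xu]|no].
  rewrite (bigD1 x)//= xu big1// => y /andP[yA yx].
  by apply/eqP; rewrite eqb0; apply: contraNN yx => yu; rewrite (F_inj _ _ yA xA _ yu xu).
by rewrite big1// => x xA; move: (no x); rewrite /= xA /= => ->.
Qed.

Section Padding.
Variables (M : monoidType) (X : finType) (f : X -> M).

Definition pad (y : X * bool) : M := if y.2 then f y.1 else 1%g.

Definition unpad (w : seq (X * bool)) : seq X := [seq y.1 | y <- w & y.2].

Lemma word_eval_pad w : word_eval pad w = word_eval f (unpad w).
Proof.
rewrite /word_eval /unpad big_map big_filter [RHS]big_mkcond.
by apply: eq_bigr => -[x []].
Qed.

(** A word with given unpadded word [u] is determined by the positions of the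
    letters of [u] and by the first components of the remaining symbols. *)
Lemma card_unpad n (u : seq X) :
  #|[pred w : n.-tuple (X * bool) | unpad w == u]| =
  ('C(n, size u) * #|X| ^ (n - size u))%N.
Proof.
pose count_unpad m (v : seq X) := (\sum_(w : m.-tuple (X * bool)) (unpad w == v))%N.
have count_unpadS m v : count_unpad m.+1 v =
    (#|X| * count_unpad m v + if v is _ :: v' then count_unpad m v' else 0)%N.
  rewrite /count_unpad sum_tupleS.
  transitivity (\sum_x \sum_b \sum_(w : m.-tuple (X * bool))
      (unpad ((x, b) :: w) == v))%N.
    by rewrite [RHS]pair_bigA; apply: eq_bigr => -[].
  under eq_bigr do rewrite big_bool.
  rewrite big_split addnC; congr addn; last by rewrite -sum_nat_const.
  case: v => [|a v'].
    by apply: big1 => x _; apply: big1.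
  rewrite (bigD1 a)//= [X in (_ + X)%N]big1 => [|x xa].
    by rewrite addn0; apply: eq_bigr => w _; rewrite /unpad /= eqseq_cons eqxx.
  apply: big1 => w _.
  by rewrite /unpad /= eqseq_cons (negPf xa).
transitivity (count_unpad n u).
  rewrite -sum1_card big_mkcond; apply: eq_bigr => w _.
  by rewrite inE; case: eqP.
elim: n u => [|n IHn] u.
  rewrite /count_unpad (big_pred1 [tuple]) => [|w].
    by case: u.
  by apply/esym/eqP; exact: tuple0.
rewrite count_unpadS IHn; case: u => [|a u].
  by rewrite addn0 !bin0 !subn0 !mul1n expnS.
rewrite IHn /= binS subSS mulnDl; congr (_ + _)%N.
case: (ltnP (size u) n) => [un|nu]; last by rewrite bin_small ?muln0.
rewrite mulnCA -expnS; congr (_ * _ ^ _)%N; lia.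
Qed.

(** Only the padded words with as many identity symbols as letters of [X] are
    taken into account. *)
Lemma pad_coincidences i j :
  (coincidences f i j *
     ('C(i.*2, i) * #|X| ^ i * ('C(j.*2, j) * #|X| ^ j)) <=
   coincidences pad i.*2 j.*2)%N.
Proof.
apply: (@leq_card_fibers _ _ _ _ (fun p => [pred q |
  (unpad (tval q.1) == tval p.1) && (unpad (tval q.2) == tval p.2)])).
- move=> [u v] _ /=.
  have := card_unpad i.*2 u; have := card_unpad j.*2 v.
  rewrite !size_tuple -!addnn !addnK => <- <-.
  by rewrite -cardX.
- move=> [u v] /eqP uv [U V] /andP[/= /eqP Uu /eqP Vv].
  by rewrite inE /= !word_eval_pad Uu Vv uv.
- move=> [u v] [u' v'] _ _ [U V] /andP[/= /eqP Uu /eqP Vv].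
  move=> /andP[/= /eqP Uu' /eqP Vv'].
  by congr pair; apply: val_inj; rewrite /= -?Uu -?Vv.
Qed.

Lemma abundant_pad (R : realType) :
  (0 < #|X|)%N -> abundant R f -> abundant R pad.
Proof.
move=> X0; apply: (@abundant_transfer _ _ _ _ _ _ _ 4 1) => //.
  by rewrite card_prod card_bool muln_gt0 X0.
move=> i j i0 j0; exists i.*2, j.*2.
rewrite !double_gt0; split => //; first lia.
rewrite card_prod card_bool; set P := coincidences f i j.
have sq4 k : (4 ^ k = 2 ^ k * 2 ^ k)%N by rewrite -expnMn.
have -> : ((#|X| * 2) ^ (i.*2 + j.*2) =
    4 ^ i * 4 ^ j * (#|X| ^ i * #|X| ^ j) * #|X| ^ (i + j))%N.
  by rewrite !sq4 expnMn -!addnn !expnD; ring.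
rewrite mulnA leq_mul2r; apply/orP; right.
apply: (@leq_trans (i.*2.+1 * j.*2.+1 * coincidences pad i.*2 j.*2)).
  apply: leq_trans (leq_mul (leqnn _) (pad_coincidences i j)).
  have := leq_mul (expn4_le_central_binomial i) (expn4_le_central_binomial j).
  move=> /(leq_mul (leqnn (P * (#|X| ^ i * #|X| ^ j)))).
  rewrite -/P; move: (P) (#|X| ^ i)%N (#|X| ^ j)%N => p xi xj h.
  by apply: leq_trans (leq_trans h _); apply/eq_leq; ring.
by rewrite leq_mul2r; apply/orP; right; nia.
Qed.

End Padding.

(** * Words of fixed length as symbols *)

Section Blocks.
Variables (M : monoidType) (Y : finType) (f : Y -> M) (e : Y) (m : nat).
Hypothesis fe : f e = 1%g.
Hypothesis m0 : (0 < m)%N.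

Definition block_eval (z : m.-tuple Y) : M := word_eval f z.

(** Beyond the end of [u] the default value of [nth] provides the identity
    symbol [e], so that cutting into blocks and padding are one operation. *)
Definition blocks a (u : seq Y) : a.-tuple (m.-tuple Y) :=
  [tuple [tuple nth e u (k * m + l) | l < m] | k < a].

Lemma nth_blocks a (u : seq Y) p : (p < a * m)%N ->
  nth e (nth [tuple of nseq m e] (blocks a u) (p %/ m)) (p %% m) = nth e u p.
Proof.
move=> pam.
have pa : (p %/ m < a)%N by rewrite ltn_divLR.
have pm : (p %% m < m)%N by rewrite ltn_mod.
rewrite -[(p %/ m)%N]/(nat_of_ord (Ordinal pa)) -tnth_nth tnth_mktuple.
rewrite -[(p %% m)%N]/(nat_of_ord (Ordinal pm)) -tnth_nth tnth_mktuple /=.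
by rewrite -divn_eq.
Qed.

Lemma blocks_inj a (u v : seq Y) : (size u <= a * m)%N -> size u = size v ->
  blocks a u = blocks a v -> u = v.
Proof.
move=> ua uv E; apply: (@eq_from_nth _ e) => // p pu.
have pa := leq_trans pu ua.
by rewrite -(nth_blocks u pa) -(nth_blocks v pa) E.
Qed.

Lemma word_eval_blocks a (u : seq Y) : (size u <= a * m)%N ->
  word_eval block_eval (blocks a u) = word_eval f u.
Proof.
move=> ua.
transitivity (\big[*%g/1%g]_(0 <= p < a * m) f (nth e u p)).
  rewrite /word_eval big_tuple.
  under eq_bigr => k _.
    rewrite tnth_mktuple /block_eval /word_eval big_tuple.
    under eq_bigr do rewrite tnth_mktuple.
    over.
  elim: (a) => [|b IHb] /=; first by rewrite big_ord0 big_geq.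
  rewrite big_ord_recr /= IHb mulSn addnC.
  rewrite [RHS](@big_cat_nat _ _ _ (b * m)) ?leq_addr//=; congr (_ * _)%g.
  rewrite -{2}[(b * m)%N]add0n big_addn addKn big_mkord.
  by apply: eq_bigr => l _; rewrite addnC.
rewrite (@big_cat_nat _ _ _ (size u))//= [X in (_ * X)%g]big1_seq; last first.
  by move=> p /andP[_]; rewrite mem_index_iota => /andP[up _]; rewrite nth_default.
by rewrite mulg1 /word_eval [RHS](big_nth e).
Qed.

Lemma blocks_coincidences i j a b : (i <= a * m)%N -> (j <= b * m)%N ->
  (coincidences f i j <= coincidences block_eval a b)%N.
Proof.
move=> ia jb.
pose pt (p : i.-tuple Y * j.-tuple Y) := (blocks a p.1, blocks b p.2).
have pt_inj : injective pt.
  move=> [u v] [u' v'] E; congr pair; apply: val_inj.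
    by apply: blocks_inj (congr1 fst E); rewrite /= !size_tuple.
  by apply: blocks_inj (congr1 snd E); rewrite /= !size_tuple.
rewrite /coincidences -(fintype.card_image pt_inj); apply/subset_leq_card/fintype.subsetP.
move=> _ /fintype.imageP[[u v] uv ->]; move: uv; rewrite !inE /=.
by rewrite !word_eval_blocks ?size_tuple.
Qed.

(** The lengths [i] and [j] are padded to the next larger multiples of [m],
    which adds at most [2 m] symbols in total. *)
Lemma abundant_blocks (R : realType) : abundant R f -> abundant R block_eval.
Proof.
have Y0 : (0 < #|Y|)%N by apply/card_gt0P; exists e.
apply: (@abundant_transfer _ _ _ _ _ _ _ (#|Y| ^ (m * 2)) m) => //.
  by rewrite card_tuple expn_gt0 Y0.
move=> i j i0 j0; exists (i %/ m).+1, (j %/ m).+1.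
have ii := divn_eq i m; have ji := divn_eq j m.
have im : (i %% m < m)%N by rewrite ltn_mod.
have jm : (j %% m < m)%N by rewrite ltn_mod.
split => //; first nia.
rewrite card_tuple -expnM.
have le1 : (m * ((i %/ m).+1 + (j %/ m).+1) <= m * 2 + (i + j))%N by nia.
have le2 : (coincidences f i j <=
    coincidences block_eval (i %/ m).+1 (j %/ m).+1)%N.
  by apply: blocks_coincidences; nia.
apply: (leq_trans (leq_mul le2 (leq_pexp2l Y0 le1))).
rewrite expnD mulnCA mulnA leq_mul2r; apply/orP; right.
by rewrite leq_mul2r leq_pmulr ?orbT.
Qed.

End Blocks.

(** * Choices of generators *)

Section FreeMonoidEval.
Variables (M : monoidType) (X : finType) (f : X -> M).

Definition free_eval : free_monoid X -> M := word_eval f.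

Fact free_evalM : {morph free_eval : u v / (u * v)%g}.
Proof. by move=> u v; exact: big_cat. Qed.

Fact free_eval1 : free_eval 1%g = 1%g.
Proof. exact: big_nil. Qed.

HB.instance Definition _ :=
  isMultiplicative.Build (free_monoid X) M free_eval free_evalM.
HB.instance Definition _ :=
  Multiplicative_isUMagmaMorphism.Build (free_monoid X) M free_eval free_eval1.

Definition generators_of (f_surj : forall a, exists w, word_eval f w = a) :
    monoid_generators M :=
  @MonoidGenerators M X free_eval f_surj.

End FreeMonoidEval.

Lemma common_length_bound (M : monoidType) (X : finType) (f : X -> M)
    (K : set M) :
  (forall a, exists w, word_eval f w = a) -> finite_set K ->
  exists m, forall a, K a -> exists2 w, (size w <= m)%N & word_eval f w = a.
Proof.
move=> f_surj /finite_seqP[s ->]; elim: s => [|b s [m IHm]]; first by exists 0%N.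
have [wb wbE] := f_surj b.
exists (maxn (size wb) m) => a /=; rewrite inE => /predU1P[->|/IHm[w wm wE]].
  by exists wb; rewrite ?leq_maxl.
by exists w; rewrite // (leq_trans wm)// leq_maxr.
Qed.

(** Blocks longer than the words chosen for the elements of [K]: each of these
    words then fits into one block, which is the required symbol. *)
Lemma representing_generators (R : realType) (M : monoidType) (X : finType)
    (f : X -> M) (K : set M) :
  (0 < #|X|)%N -> (forall a, exists w, word_eval f w = a) -> abundant R f ->
  finite_set K ->
  exists G : monoid_generators M, mg_maximal_cogrowth R G /\ mg_represents G K.
Proof.
move=> X0 f_surj f_ab Kfin; have [x0 _] := card_gt0P X0.
have [m mP] := common_length_bound f_surj Kfin.
pose e : X * bool := (x0, false).
pose g := @block_eval M _ (pad f) m.+1.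
have fe : pad f e = 1%g by [].
have gE a (w : seq X) : (size w <= a * m.+1)%N ->
    word_eval g (blocks e m.+1 a [seq (x, true) | x <- w]) = word_eval f w.
  move=> wa; rewrite word_eval_blocks ?size_map// word_eval_pad.
  by congr word_eval; elim: w {wa} => //= x w; rewrite /unpad /= => ->.
have g_surj a : exists w, word_eval g w = a.
  have [w <-] := f_surj a.
  by exists (blocks e m.+1 (size w) [seq (x, true) | x <- w]); rewrite gE ?leq_pmulr.
exists (generators_of g_surj); split.
  have g_ab : abundant R g by apply: (abundant_blocks fe) => //; exact: abundant_pad.
  apply/(maximal_cogrowthP (f := g)) => //=.
  by rewrite card_tuple expn_gt0 card_prod card_bool muln_gt0 X0.
move=> a /mP[w wm <-].
have := gE 1%N w; rewrite mul1n => <-; last exact: leqW.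
move: (blocks _ _ _ _) => [[|z [|? ?]] //= _].
by exists z.
Qed.

(** The evaluation [ev] may take its values elsewhere than in [M], which covers
    both generators of [S] as a semigroup and as a monoid when [M] is [S^1];
    only its kernel matters.  An empty alphabet cannot be padded with identity
    symbols; it generates only the trivial monoid, for which a single symbol
    serves instead. *)
Lemma maximal_generators (R : realType) (M : monoidType) (X : finType)
    (f : X -> M) (T : Type) (ev : free_semigroup X -> T) (K : set M) :
  (forall u v, ev u = ev v <-> word_eval f (val u) = word_eval f (val v)) ->
  (forall a, exists w, word_eval f w = a) ->
  maximal_global_cogrowth R ev -> finite_set K ->
  exists G : monoid_generators M, mg_maximal_cogrowth R G /\ mg_represents G K.
Proof.
move=> evP f_surj ev_max Kfin.
have [X0|X0] := posnP #|X|; last first.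
  by apply: (representing_generators X0 f_surj) => //; exact/(maximal_cogrowthP evP).
have M1 (a : M) : a = 1%g.
  have [[|x w] <-] := f_surj a; first exact: big_nil.
  by have := card0_eq X0 x; rewrite inE.
apply: (@representing_generators R M unit (fun=> 1%g)) => //.
- by rewrite card_unit.
- by move=> a; exists [::]; exact: etrans (M1 _) (esym (M1 _)).
(* In a trivial monoid all words over the one-letter alphabet agree. *)
move=> r /andP[r0 r1] N; exists N.+1, N.+1; split => //; first lia.
rewrite card_unit mulr1 (le_trans (exprn_ile1 _ r0 (ltW r1)))// ler1n.
apply/card_gt0P; exists ([tuple tt | _ < _], [tuple tt | _ < _]).
by rewrite inE; apply/eqP; exact: etrans (M1 _) (esym (M1 _)).
Qed.

(** [S] being a monoid, [S^1] has no new element, so that the image of the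
    identity of [S] is neutral in [S^1]. *)
Lemma to_adjoin1_1 (S : monoidType) : to_adjoin1 (1%g : S) = 1%g.
Proof.
have [|b bE] := @to_adjoin1_surj S _ 1%g.
  by exists 1%g => x; rewrite mul1g mulg1.
by rewrite -[LHS]mulg1 -bE -to_adjoin1M mul1g.
Qed.

Lemma adjoin1_case (S : semigroupType) (a : adjoin1 S) :
  a = 1%g \/ exists s, to_adjoin1 s = a.
Proof.
case: (pselect (has_identity S)) => [h|h]; first by right; exact: to_adjoin1_surj.
by case: (pselect (exists s, to_adjoin1 s = a)); [right|left; exact/adjoin1_new].
Qed.

Lemma to_adjoin1_semigroup_eval (S : semigroupType) (X : finType)
    (ev : {multiplicative free_semigroup X -> S}) (u : free_semigroup X) :
  to_adjoin1 (ev u) =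
  word_eval (fun x => to_adjoin1 (ev (Sub [:: x] isT))) (val u).
Proof.
case: u => w w0; elim: w w0 => [|x w IHw] // w0 /=.
rewrite /word_eval big_cons; case: w IHw w0 => [|y w] IHw w0.
  rewrite big_nil mulg1; congr (to_adjoin1 (ev _)); exact: val_inj.
rewrite -[X in (_ * X)%g](IHw isT) -to_adjoin1M -gmulfM.
by congr (to_adjoin1 (ev _)); exact: val_inj.
Qed.

Lemma to_adjoin1_monoid_eval (S : monoidType) (X : finType)
    (ev : UMagmaMorphism.type (free_monoid X) S) (w : seq X) :
  to_adjoin1 (ev w) = word_eval (fun x => to_adjoin1 (ev [:: x])) w.
Proof.
elim: w => [|x w IHw]; first by rewrite /word_eval big_nil gmulf1 to_adjoin1_1.
rewrite /word_eval big_cons -[X in (_ * X)%g]IHw -to_adjoin1M.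
by rewrite -[in RHS]gmulfM.
Qed.

Theorem theorem4p25 (R : realType) :
  (forall S : semigroupType,
     (exists G : semigroup_generators S, sg_maximal_cogrowth R G) ->
     forall K : set (adjoin1 S), finite_set K ->
       exists G : monoid_generators (adjoin1 S),
         mg_maximal_cogrowth R G /\ mg_represents G K) /\
  (forall S : monoidType,
     (exists G : monoid_generators S, mg_maximal_cogrowth R G) ->
     forall K : set (adjoin1 S), finite_set K ->
       exists G : monoid_generators (adjoin1 S),
         mg_maximal_cogrowth R G /\ mg_represents G K).
Proof.
split=> S [G Gmax] K.
  apply: (maximal_generators (f := fun x => to_adjoin1 (sg_eval G (Sub [:: x] isT)))
    _ _ Gmax) => [u v|a].
    rewrite -!to_adjoin1_semigroup_eval.
    by split=> [->|] //; exact: to_adjoin1_inj.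
  case: (adjoin1_case a) => [->|[s <-]]; first by exists [::]; exact: big_nil.
  have [u <-] := sg_surj G s.
  by exists (val u); rewrite -to_adjoin1_semigroup_eval.
apply: (maximal_generators (f := fun x => to_adjoin1 (mg_eval G [:: x])) _ _ Gmax) => [u v|a].
  rewrite -!to_adjoin1_monoid_eval.
  by split=> [->|] //; exact: to_adjoin1_inj.
case: (adjoin1_case a) => [->|[s <-]]; first by exists [::]; exact: big_nil.
have [u <-] := mg_surj G s.
by exists u; rewrite -to_adjoin1_monoid_eval.
Qed.
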